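(* Let $L$ and $N$ be arbitrary positive integers and $q$ a non-zero complex number. Let $C_q(N,L)$ be the algebra with invertible generators $\chi_i(n)$ described in the context, and let $\kappa_+$ and $\kappa_-$ be the maps defined on generators by $$\kappa_\pm\colon\ \chi_i(n\mp1)\mapsto\chi_i(n)\qquad (n\ \text{even}),$$ $$\kappa_\pm\colon\ \chi_i(n\mp1)\mapsto q^{-2}\,\frac{1-\chi_{i-1}(n+1)}{1-q^{-2}\chi_i^{-1}(n+1)}\;\frac{1-\chi_{i+1}(n-1)}{1-q^{-2}\chi_i^{-1}(n-1)}\;\chi_i^{-1}(n)\qquad (n\ \text{odd}).$$ Then the maps $\kappa_+$ and $\kappa_-$, extended by linearity to the whole algebra $C_q(N,L)$, determine automorphisms of this algebra (with the understanding about completions stated in the context).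
   Context: For a positive integer $m$, let $\delta_m(n)=1$ if $m$ divides the integer $n$ and $\delta_m(n)=0$ otherwise. $C_q(N,L)$ is the algebra generated by invertible elements $\chi_i(n)$, $i=1,\dots,N$, $n=1,\dots,2L$, where $i$ is taken modulo $N$ and $n$ modulo $2L$ (so $\chi_{i+N}(n)=\chi_i(n+2L)=\chi_i(n)$), with the commutation relations $$\chi_i(n)\chi_j(m)=\chi_j(m)\chi_i(n)\quad\text{if } n-m \text{ is even},$$ $$\chi_i(n)\chi_j(m)=q^{\Omega(i-j,(n-m-1)/2)}\chi_j(m)\chi_i(n)\quad\text{if } n\text{ is even and } m\text{ is odd},$$ where $$\Omega(i,n)=2\delta_L(n)\bigl(\delta_N(i)-\delta_N(i+1)\bigr)+2\delta_L(n+1)\bigl(\delta_N(i)-\delta_N(i-1)\bigr).$$ Strictly speaking, $\kappa_\pm$ act from the algebra to a completion of it, which can be defined in many ways: for example, one can consider Laurent power series in $\chi$ or in $\chi-1$, or realize the $\chi_i(n)$ as operators in a Hilbert space and use the spectral theorem to define rational functions of an operator. No particular choice of completion is made.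
   Formalization: For L = 1 the claim is stated only when every constant q^Ω equals 1 (commutative algebra), since it fails otherwise (e.g. N = 2, q^4 ≠ 1: images of χ_0(0), χ_1(0) do not commute); the automorphism is taken on the division algebra of fractions. *)

(* Defs.v *)
From mathcomp Require Import all_boot all_order all_algebra.
From mathcomp Require Import reals.
From mathcomp Require Import complex.

Set Implicit Arguments.
Unset Strict Implicit.
Unset Printing Implicit Defensive.

Import Order.TTheory GRing.Theory Num.Theory.
Local Open Scope ring_scope.

Definition delta (m : nat) (n : int) : int := if (m%:Z %| n)%Z then 1 else 0.

Definition Omega (N L : nat) (i n : int) : int :=
  2 * delta L n * (delta N i - delta N (i + 1))
  + 2 * delta L (n + 1) * (delta N i - delta N (i - 1)).

Definition even (n : int) : bool := (2 %| n)%Z.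

(* The indices taken modulo N and modulo 2L are encoded as periodic families
   over int * int.  In [cg_even_odd] the difference n - m - 1 is even, so the
   integer quotient by 2 is exact. *)
Record Cq_generators (R : realType) (N L : nat) (q : R[i])
    (A : unitAlgType R[i]) (x : int -> int -> A) : Prop := {
  cg_periodic_i : forall i n, x (i + N%:Z) n = x i n;
  cg_periodic_n : forall i n, x i (n + 2 * L%:Z) = x i n;
  cg_unit : forall i n, x i n \is a GRing.unit;
  cg_same_parity : forall i j n m, even (n - m) -> x i n * x j m = x j m * x i n;
  cg_even_odd : forall i j n m, even n -> ~~ even m ->
    x i n * x j m =
      q ^ Omega N L (i - j) ((n - m - 1) %/ 2)%Z *: (x j m * x i n)
}.

(* C, with the family chi, is the algebra with invertible generators chi i n
   and the above defining relations: chi is the universal such family.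
   Asking for unitAlgType only provides the notation x^-1; classically every
   nonzero algebra has this structure, in exactly one way on units. *)
Definition is_Cq (R : realType) (N L : nat) (q : R[i])
    (C : unitAlgType R[i]) (chi : int -> int -> C) : Prop :=
  Cq_generators N L q chi /\
  forall (B : unitAlgType R[i]) (x : int -> int -> B),
    Cq_generators N L q x ->
    exists f : {lrmorphism C -> B},
      (forall i n, f (chi i n) = x i n) /\
      (forall g : {lrmorphism C -> B},
         (forall i n, g (chi i n) = x i n) -> g =1 f).

(* The factors with indices n + 1 and n - 1 commute when chi satisfies the
   relations (both indices have the same parity), so writing the fractions as
   right quotients is not a choice.
   For L = 1 the indices n + 1 and n - 1 coincide modulo 2L and the exponents in
   the relations double; the elements [kappa_rhs q x i n] and
   [kappa_rhs q x j n], n odd, then fail to commute as soon as the algebra is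
   not commutative, so L = 1 is only meaningful when all the constants
   q ^ Omega N L i n are 1. *)
Definition kappa_rhs (R : realType) (q : R[i]) (D : unitAlgType R[i])
    (x : int -> int -> D) (i n : int) : D :=
  q ^- 2 *:
    ((1 - x (i - 1) (n + 1)) / (1 - q ^- 2 *: (x i (n + 1))^-1)
     * ((1 - x (i + 1) (n - 1)) / (1 - q ^- 2 *: (x i (n - 1))^-1))
     * (x i n)^-1).

(* [kappa_on s q chi x f]: f is given on the generators chi by the formulas of
   kappa_+ (for s = 1) or kappa_- (for s = -1), where x is the image of chi in
   the completion D. *)
Definition kappa_on (s : int) (R : realType) (q : R[i])
    (C D : unitAlgType R[i]) (chi : int -> int -> C) (x : int -> int -> D)
    (f : C -> D) : Prop :=
  (forall i n, even n -> f (chi i (n - s)) = x i n) /\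
  (forall i n, ~~ even n -> f (chi i (n - s)) = kappa_rhs q x i n).

(* An arbitrary target in which the right-hand sides of the maps make sense and
   are invertible, as images of invertible generators have to be. *)
Definition kappa_defined (R : realType) (q : R[i]) (D : unitAlgType R[i])
    (x : int -> int -> D) : Prop :=
  forall i n, even n ->
    1 - x i n \is a GRing.unit /\
    1 - q ^- 2 *: (x i n)^-1 \is a GRing.unit.

(* D is the division algebra of fractions of C, i.e. the algebra of rational
   functions of the generators.  It exists for the algebras considered here,
   since quantum tori are Ore domains. *)
Definition is_fractions (R : realType) (C D : unitAlgType R[i])
    (iota : {lrmorphism C -> D}) : Prop :=
  (forall a : C, a != 0 -> iota a \is a GRing.unit) /\
  (forall d : D, exists a b : C, b != 0 /\ d = iota a / iota b).

(* Main.v *)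
(* kappa_s is the composition of an automorphism T and a map theta. T sends
   chi_i(n - s) to chi_i(n) for n even and to chi_i(n)^-1 for n odd. theta fixes
   chi_i(n) for n even and sends it to chi_i(n) g_i(n)^-1 for n odd, where
   g_i(n) chi_i(n)^-1 is the right-hand side in the definition of kappa_s.
   theta preserves the relations: after moving the odd generators to one side this
   becomes an identity between commuting elements, which follows from
   (1 - q^2 v) / (1 - q^-2 v^-1) = -q^2 v and (1 - v) / (1 - v^-1) = -v.
   The inverse of theta should be theta': chi_i(n) |-> chi_i(n) g_i(n), n odd. To
   extend both to the division algebra of fractions one needs them to be
   injective. Both fix the commutative algebra E generated by the even
   generators, and the nonzero elements of E form an Ore set; so theta' extends to
   the localization at E, which contains the image of theta, and there
   theta' theta is the identity. *)
Require Import Defs.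
From HB Require Import structures.
From mathcomp Require Import all_boot all_order all_algebra.
From mathcomp Require Import boolp reals.
From mathcomp Require Import complex ring zify.

Set Implicit Arguments.
Unset Strict Implicit.
Unset Printing Implicit Defensive.

Import Order.TTheory GRing.Theory Num.Theory.
Local Open Scope ring_scope.

(** * Subalgebras *)

Section Subalgebra.
Variables (F : fieldType) (A : unitAlgType F) (S : A -> Prop).
Hypothesis S1 : S 1.
Hypothesis SD : forall a b, S a -> S b -> S (a + b).
Hypothesis SM : forall a b, S a -> S b -> S (a * b).
Hypothesis SZ : forall (k : F) a, S a -> S (k *: a).

Definition subalg_pred : {pred A} := fun a => `[< S a >].

Lemma subalg_predP : GRing.subalg_closed subalg_pred.
Proof.
split=> [|k a b /asboolP Sa /asboolP Sb|a b /asboolP Sa /asboolP Sb].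
- exact/asboolP.
- by apply/asboolP; apply: SD => //; apply: SZ.
- exact/asboolP/SM.
Qed.
HB.instance Definition _ := GRing.isSubalgClosed.Build F A subalg_pred subalg_predP.

Record subalg := Subalg { subalg_val : A; _ : subalg_val \in subalg_pred }.
HB.instance Definition _ := [isSub for subalg_val].
HB.instance Definition _ := [Choice of subalg by <:].
HB.instance Definition _ := [SubChoice_isSubAlgebra of subalg by <:].

(* All two-sided invertible elements of the subalgebra, whose inverses need not be
   the restriction of ^-1 when S is not closed under inverses. *)
Definition sunit : {pred subalg} :=
  fun u => `[< exists v, v * u = 1 /\ u * v = 1 >].
Definition sinv (u : subalg) : subalg :=
  match pselect (exists v, v * u = 1 /\ u * v = 1) with
  | left e => projT1 (cid e) | right _ => u end.

Fact sinvL : {in sunit, left_inverse 1 sinv *%R}.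
Proof.
move=> u /asboolP hu; rewrite /sinv; case: pselect => // e.
by case: (cid e) => v /= [].
Qed.
Fact sinvR : {in sunit, right_inverse 1 sinv *%R}.
Proof.
move=> u /asboolP hu; rewrite /sinv; case: pselect => // e.
by case: (cid e) => v /= [].
Qed.
Fact sunitP u v : v * u = 1 /\ u * v = 1 -> u \in sunit.
Proof. by move=> h; apply/asboolP; exists v. Qed.
Fact sinv_out : {in [predC sunit], sinv =1 id}.
Proof.
by move=> u /asboolP hu; rewrite /sinv; case: pselect.
Qed.
HB.instance Definition _ := GRing.NzRing_hasMulInverse.Build subalg
  sinvL sinvR sunitP sinv_out.

Definition subalg_incl (u : subalg) : A := val u.

Fact subalg_incl_linear : linear subalg_incl. Proof. by []. Qed.
Fact subalg_incl_monoid : monoid_morphism subalg_incl. Proof. by []. Qed.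
HB.instance Definition _ :=
  GRing.isLinear.Build F subalg A *:%R subalg_incl subalg_incl_linear.
HB.instance Definition _ :=
  GRing.isMonoidMorphism.Build subalg A subalg_incl subalg_incl_monoid.

(** Packages [S] as a unit algebra, so that it can serve as a target in the universal property of
    [C]. *)
Lemma subalg_type : exists (B : unitAlgType F) (v : {lrmorphism B -> A}),
  [/\ injective v, forall u, S (v u), forall a, S a -> exists u, v u = a &
      forall u w, v u * v w = 1 -> v w * v u = 1 -> u \is a GRing.unit].
Proof.
exists subalg, subalg_incl.
split=> [||a Sa|u w uw wu] /=.
- exact: val_inj.
- by case=> a Sa; apply/asboolP.
- by exists (Subalg (introT (asboolP _) Sa)).
- by apply/asboolP; exists w; split; apply: val_inj.
Qed.

End Subalgebra.

(** * Commutative subalgebras closed under inverses *)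

Section CommutativeHull.
Variables (F : fieldType) (A : unitAlgType F).
Hypothesis AC : commutative (@GRing.mul A).

(** An alias, so that the commutative structure does not compete with the given one on [A]. *)
Definition comm_alias : Type := A.
HB.instance Definition _ := GRing.UnitAlgebra.on comm_alias.
HB.instance Definition _ := GRing.PzRing_hasCommutativeMul.Build comm_alias AC.

Definition comm_incl (a : comm_alias) : A := a.

Fact comm_incl_linear : linear comm_incl. Proof. by []. Qed.
Fact comm_incl_monoid : monoid_morphism comm_incl. Proof. by []. Qed.
HB.instance Definition _ :=
  GRing.isLinear.Build F comm_alias A *:%R comm_incl comm_incl_linear.
HB.instance Definition _ :=
  GRing.isMonoidMorphism.Build comm_alias A comm_incl comm_incl_monoid.

Lemma comm_alg_type : exists (B : comUnitAlgType F) (v : {lrmorphism B -> A}),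
  [/\ injective v, forall a, exists u, v u = a &
      forall u, v u \is a GRing.unit -> u \is a GRing.unit].
Proof. by exists comm_alias, comm_incl; split=> // a; exists a. Qed.

End CommutativeHull.

Definition centralizes (R : pzRingType) (P : R -> Prop) (a : R) :=
  forall b, P b -> a * b = b * a.

(* The double centralizer of S is commutative and closed under inverses. *)
Lemma comm_hull (F : fieldType) (A : unitAlgType F) (S : A -> Prop) :
  (forall a b, S a -> S b -> a * b = b * a) ->
  exists (B : comUnitAlgType F) (v : {lrmorphism B -> A}),
    [/\ injective v, forall a, S a -> exists u, v u = a &
        forall u, v u \is a GRing.unit -> u \is a GRing.unit].
Proof.
move=> SC; set T := centralizes (centralizes S).
have T1 : T 1 by move=> b _; rewrite mul1r mulr1.
have TD a b : T a -> T b -> T (a + b).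
  by move=> Ta Tb c Sc; rewrite mulrDl mulrDr Ta ?Tb.
have TM a b : T a -> T b -> T (a * b).
  by move=> Ta Tb c Sc; rewrite -mulrA Tb // mulrA Ta // mulrA.
have TZ (k : F) a : T a -> T (k *: a).
  by move=> Ta c Sc; rewrite -scalerAl -scalerAr Ta.
have TV a : T a -> T a^-1.
  move=> Ta c Sc; case: (boolP (a \is a GRing.unit)) => [ua|nua]; last first.
    by rewrite invr_out ?Ta.
  by apply: (mulrI ua); rewrite mulrA mulrV // mul1r mulrA Ta // -mulrA mulrV ?mulr1.
have [B [v [vI vT Tv vU]]] := subalg_type T1 TD TM TZ.
have BC : commutative (@GRing.mul B).
  move=> a b; apply: vI; rewrite !rmorphM.
  by apply: (vT) => c Sc; apply: (vT) => d Sd; apply: SC.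
have [K [w [wI ws wU]]] := comm_alg_type BC.
exists K, (v \o w); split=> [||u uv].
- exact: inj_comp.
- move=> a Sa; have [|u <-] := Tv a; first by move=> b cb; rewrite cb.
  by have [u' <-] := ws u; exists u'.
- apply: wU; have [u' eu'] := Tv _ (TV _ (vT (w u))).
  by apply: (vU _ u'); rewrite eu' ?mulrV ?mulVr.
Qed.

(** * The exchange relation *)

Lemma deltaN m n : delta m (- n) = delta m n.
Proof. by rewrite /delta rpredN. Qed.

(** Exchanging the generators at (i, n) and (j, m) turns k = (n - m - 1) / 2 into - k - 1, and the
    two summands of [Omega] trade places. *)
Lemma Omega_opp N L i k : Omega N L (- i) (- k - 1) = Omega N L i k.
Proof.
have deltaE m a b : a = - b -> delta m a = delta m b by move=> ->; apply: deltaN.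
rewrite /Omega (deltaE L (- k - 1) (k + 1)) ?(deltaE L (- k - 1 + 1) k); try ring.
rewrite deltaN (deltaE N (- i + 1) (i - 1)) ?(deltaE N (- i - 1) (i + 1)); ring.
Qed.

Lemma shift_periodic (T : Type) (f : int -> T) (p a b : int) :
  (forall n, f (n + p) = f n) -> (p %| a - b)%Z -> f a = f b.
Proof.
move=> fp /dvdzP[k e]; have -> : a = b + k * p by rewrite -e; ring.
have fz (m : nat) c : f (c + m%:Z * p) = f c.
  by elim: m => [|m IH]; rewrite ?mul0r ?addr0 // -addn1 PoszD mulrDl mul1r addrA fp.
case: k {e} => m; first exact: fz.
rewrite -(fz m.+1); congr f; rewrite NegzE; ring.
Qed.

(** The g_i(n) of the header, that is [kappa_rhs] without its last factor. For odd [n] it involves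
    generators of even index only. *)
Definition gfrac (R : realType) (q : R[i]) (D : unitAlgType R[i])
    (x : int -> int -> D) (i n : int) : D :=
  q ^- 2 *: ((1 - x (i - 1) (n + 1)) / (1 - q ^- 2 *: (x i (n + 1))^-1)
     * ((1 - x (i + 1) (n - 1)) / (1 - q ^- 2 *: (x i (n - 1))^-1))).

(* The family x conjugated by (x i n)^-1 for n odd, see [inv_conj]. *)
Definition conj_gens (R : realType) (N L : nat) (q : R[i]) (D : unitAlgType R[i])
    (x : int -> int -> D) (i n : int) : int -> int -> D :=
  fun k c => q ^ Omega N L (i - k) ((n - c - 1) %/ 2)%Z *: x k c.

Section Exchange.
Variables (R : realType) (N L : nat) (q : R[i]) (K : comUnitAlgType R[i]).
Variable x : int -> int -> K.
Hypothesis hq : q != 0.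
Hypothesis xi : forall i n, x (i + N%:Z) n = x i n.
Hypothesis xn : forall i n, x i (n + 2 * L%:Z) = x i n.
Hypothesis xU : forall i n, even n -> x i n \is a GRing.unit.
Hypothesis x1 : forall i n, even n -> 1 - x i n \is a GRing.unit.
Hypothesis xq : forall i n, even n -> 1 - q ^- 2 *: (x i n)^-1 \is a GRing.unit.

Local Notation E v := (1 - v).
Local Notation F v := (1 - q ^- 2 *: v^-1)^-1.

(* Both sides are equal to -q^2 v. *)
Lemma dilog_ratio i n : even n -> let v := x i n in
  F v * E (q ^+ 2 *: v) = q ^+ 2 *: (E v * F (q ^- 2 *: v)).
Proof.
move=> en v; have U := xU i en; have U1 := x1 i en; have Uq := xq i en.
have Q : q ^+ 2 != 0 by rewrite expf_neq0.
have UQ : q ^+ 2 \is a GRing.unit by rewrite unitfE.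
have -> : E (q ^+ 2 *: v) = - (q ^+ 2 *: v) * (1 - q ^- 2 *: v^-1).
  rewrite mulrBr mulr1 mulNr opprK -scalerAl -scalerAr scalerA mulfV // scale1r.
  by rewrite mulrV // addrC.
rewrite mulrC mulrK // invrZ //; last by rewrite unitrV.
rewrite scalerA invrK mulVf // scale1r.
have -> : 1 - v^-1 = - (v^-1 * (1 - v)).
  by rewrite mulrBr mulr1 mulVr // opprB.
by rewrite invrN invrM ?unitrV // invrK mulrN mulrA mulrV // mul1r scalerN.
Qed.

(** Both sides equal [c *: (e * e' * g * g')]. The hypotheses will be two instances of
    [dilog_ratio], with c = q^2. *)
Lemma exchange_ratios (c : R[i]) (e e' f f' d d' g g' : K) :
  f * d = c *: (e * g) -> f' * d' = c *: (e' * g') ->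
  e * f' * d' * g = e' * f * d * g'.
Proof.
move=> h h'; transitivity (e * g * (f' * d')); first by ring.
transitivity (e' * g' * (f * d)); last by ring.
by rewrite h h' -!scalerAr mulrC.
Qed.

Lemma xi_eq a b n : (N %| a - b)%Z -> x a n = x b n.
Proof. by move=> h; apply: (shift_periodic (f := fun a => x a n)) h => c; apply: xi. Qed.

Lemma xn_eq i a b : (L %| a)%Z -> x i (b + 2 * a) = x i b.
Proof.
move=> /dvdzP[k ->]; apply: (shift_periodic (f := fun a => x i a) (p := 2 * L%:Z)).
  by move=> c; apply: xn.
by apply/dvdzP; exists k; ring.
Qed.

Lemma OmegaE i k : Omega N L i k =
  (if (L %| k)%Z then 2 * ((N %| i)%Z%:R - (N %| (i + 1))%Z%:R) else 0)
  + (if (L %| (k + 1))%Z then 2 * ((N %| i)%Z%:R - (N %| (i - 1))%Z%:R) else 0).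
Proof.
rewrite /Omega /delta.
by case: (_ %| k)%Z; case: (_ %| k + 1)%Z; case: (N %| i)%Z;
  case: (N %| i + 1)%Z; case: (N %| i - 1)%Z.
Qed.

Lemma dvdz_near (m a b : int) (h : (m %| a - b)%Z) : (m %| a)%Z = (m %| b)%Z.
Proof. by rewrite -[a](subrK b) rpredDl. Qed.

Let xp2 (v : K) : q ^ (2 : int) *: v = q ^+ 2 *: v. Proof. by []. Qed.
Let xm2 (v : K) : q ^ (- 2 : int) *: v = q ^- 2 *: v. Proof. by []. Qed.

(** One half of g_i, at index [c], meets the opposite half of g_j, at index [c']. As [L] does not
    divide k + 1, only the first summand of [Omega] contributes. If [L] does not divide k either,
    all exponents vanish; otherwise [c] and [c'] agree modulo 2L. *)
Lemma exchange_column i j c c' k : even c -> even c' -> c = c' + 2 * k ->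
  ~~ (L %| (k + 1))%Z ->
  let a := q ^ Omega N L (i - j + 1) k in let b := q ^ Omega N L (i - j) k in
  E (x (i + 1) c) * F (x i c) * E (a *: x (j - 1) c') * F (b *: x j c') =
  E (x (j - 1) c') * F (x j c') * E (a *: x (i + 1) c) * F (b *: x i c).
Proof.
move=> ec ec' cE Lk a b; rewrite {}/a {}/b.
rewrite !OmegaE (negPf Lk) !addr0.
have [Lk0|_] := boolP (L %| k)%Z; last by rewrite expr0z !scale1r; ring.
have xc l : x l c = x l c' by rewrite cE xn_eq.
rewrite !{}xc {cE ec}.
have -> : i - j + 1 + 1 = i - j + 2 by ring.
have [r1|r1] := boolP (N %| i - j + 1)%Z.
  rewrite -(@xi_eq i (j - 1)); last by rewrite opprB addrA addrAC.
  rewrite (@xi_eq (i + 1) j); last by rewrite addrAC.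
  have [r2|r2] := boolP (N %| i - j + 2)%Z.
    have -> : (N %| i - j)%Z.
      have -> : i - j = (i - j + 1) *+ 2 - (i - j + 2) by ring.
      by rewrite rpredB // rpredMn.
    by rewrite subrr mulr0 expr0z !scale1r; ring.
  have -> : (N %| i - j)%Z = false.
    apply: contraNF r2 => r0; have -> : i - j + 2 = (i - j + 1) *+ 2 - (i - j) by ring.
    by rewrite rpredB // rpredMn.
  (* The arguments of E are rescaled by q^2 and those of F by q^-2, as in [dilog_ratio]. *)
  rewrite subr0 sub0r mulr1 mulrN1 !xp2 !xm2.
  exact: exchange_ratios (dilog_ratio j ec') (dilog_ratio i ec').
(* Away from i = j - 1 modulo N, a nontrivial rescaling only hits generators that coincide on both
   sides, so commutativity suffices. *)
rewrite sub0r subr0.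
have [r2|_] := boolP (N %| i - j + 2)%Z.
  rewrite (@xi_eq (i + 1) (j - 1)); last first.
    by have -> : i + 1 - (j - 1) = i - j + 2 by ring.
  have [r0|_] := boolP (N %| i - j)%Z; first by rewrite (@xi_eq i j) //; ring.
  by rewrite mulr0 expr0z !scale1r; ring.
have [r0|_] := boolP (N %| i - j)%Z; first rewrite (@xi_eq i j) //.
  by rewrite oppr0 mulr0 expr0z !scale1r; ring.
by rewrite oppr0 mulr0 expr0z !scale1r; ring.
Qed.

(** Covers n = m modulo 2L, where both fractions involve the same two even indices and the halves
    have to be treated together. As L > 1, each exponent retains a single summand of [Omega]. *)
Lemma exchange_same_row i j c c' : even c -> even c' -> ~~ (N %| i - j)%Z -> (1 < L)%N ->
  let a := q ^ Omega N L (i - j + 1) (- 1)%R in let b := q ^ Omega N L (i - j) (- 1)%R in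
  let a' := q ^ Omega N L (i - j - 1) 0%R in let b' := q ^ Omega N L (i - j) 0%R in
  (E (x (i - 1) c) * F (x i c)) * (E (x (i + 1) c') * F (x i c')) *
    ((E (a *: x (j - 1) c) * F (b *: x j c)) *
     (E (a' *: x (j + 1) c') * F (b' *: x j c'))) =
  (E (x (j - 1) c) * F (x j c)) * (E (x (j + 1) c') * F (x j c')) *
    ((E (a' *: x (i - 1) c) * F (b' *: x i c)) *
     (E (a *: x (i + 1) c') * F (b *: x i c'))).
Proof.
move=> ec ec' r0 L1 a b a' b'; rewrite {}/a {}/b {}/a' {}/b'.
have L2 : (L %| 1)%N = false by rewrite dvdn1 gtn_eqF.
rewrite !OmegaE !add0r (_ : (- 1 + 1 : int) = 0) // !dvdz0 (negPf r0).
rewrite !(dvdzE _ (- 1)) !(dvdzE L 1) /= L2 add0r !addr0 addrK subrK (negPf r0).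
have [r1|r1] := boolP (N %| i - j + 1)%Z; have [r2|r2] := boolP (N %| i - j - 1)%Z;
  rewrite ?subr0 ?sub0r ?mulr1 ?mulrN1 ?oppr0 ?mulr0 ?expr0z ?scale1r ?xp2 ?xm2.
(* Both neighbours of [i] coincide with [j], which means N = 2: one exchange takes place at each of
   the two indices. *)
- rewrite -(@xi_eq i (j - 1)); last by rewrite opprB addrA addrAC.
  rewrite -(@xi_eq i (j + 1)); last by rewrite opprD addrA.
  rewrite (@xi_eq (i - 1) j); last by rewrite addrAC.
  rewrite (@xi_eq (i + 1) j); last by rewrite addrAC.
  have s1 := exchange_ratios (dilog_ratio j ec) (dilog_ratio i ec).
  have s2 := exchange_ratios (dilog_ratio j ec') (dilog_ratio i ec').
  by apply: etrans (etrans (congr2 *%R s1 s2) _); ring.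
(* Only i + 1 = j modulo N: a single exchange mixes the two indices, and [w] collects the factors
   that it leaves alone. *)
- rewrite -(@xi_eq i (j - 1)); last by rewrite opprB addrA addrAC.
  rewrite (@xi_eq (i + 1) j); last by rewrite addrAC.
  have s := exchange_ratios (dilog_ratio j ec') (dilog_ratio i ec).
  pose w := E (x (i - 1) c) * F (x i c') * F (x j c) * E (x (j + 1) c').
  by apply: etrans (etrans (congr1 ( *%R w) s) _); rewrite /w; ring.
- rewrite -(@xi_eq i (j + 1)); last by rewrite opprD addrA.
  rewrite (@xi_eq (i - 1) j); last by rewrite addrAC.
  have s := exchange_ratios (dilog_ratio j ec) (dilog_ratio i ec').
  pose w := E (x (i + 1) c') * F (x i c) * F (x j c') * E (x (j - 1) c).
  by apply: etrans (etrans (congr1 ( *%R w) s) _); rewrite /w; ring.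
- by ring.
Qed.

(** The identity between commuting elements announced in the header. Write n = m + 2d. If [L] does
    not divide d, the half at n - 1 interacts only with the half at m + 1, and the half at n + 1
    only with the half at m - 1. If [L] divides d, the indices of both fractions coincide modulo
    2L. *)
Lemma gfrac_exchange_comm i j n m : ~~ even n -> ~~ even m ->
  (1 < L)%N \/ (forall i n : int, q ^ Omega N L i n = 1) ->
  gfrac q x i n * gfrac q (conj_gens N L q x i n) j m =
  gfrac q x j m * gfrac q (conj_gens N L q x j m) i n.
Proof.
move=> on om [L1|Q1]; last first.
  have W k l : conj_gens N L q x k l = x.
    by apply/funext => a; apply/funext => b; rewrite /conj_gens Q1 scale1r.
  by rewrite !W mulrC.
have [d dE] : exists d, n = m + 2 * d by exists ((n - m) %/ 2)%Z; rewrite /even in on om; lia.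
rewrite /gfrac /conj_gens -!(scalerAl, scalerAr); do 2 congr (_ *: _).
have -> : ((n - (m + 1) - 1) %/ 2)%Z = d - 1 by lia.
have -> : ((n - (m - 1) - 1) %/ 2)%Z = d by lia.
have -> : ((m - (n + 1) - 1) %/ 2)%Z = - d - 1 by lia.
have -> : ((m - (n - 1) - 1) %/ 2)%Z = - (d - 1) - 1 by lia.
have -> : j - (i - 1) = - (i - j - 1) by ring.
have -> : j - (i + 1) = - (i - j + 1) by ring.
rewrite -![j - i]opprB !Omega_opp.
have -> : i - (j - 1) = i - j + 1 by ring.
have -> : i - (j + 1) = i - j - 1 by ring.
have en1 : even (n + 1) by rewrite /even in on *; lia.
have en2 : even (n - 1) by rewrite /even in on *; lia.
have em1 : even (m + 1) by rewrite /even in om *; lia.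
have em2 : even (m - 1) by rewrite /even in om *; lia.
have [Ld|Ld] := boolP (L %| d)%Z; last first.
  have h1 := @exchange_column i j (n - 1) (m + 1) (d - 1) en2 em1.
  have h2 := @exchange_column j i (m - 1) (n + 1) (- d - 1) em2 en1.
  move: h1 h2; rewrite !subrK rpredN (negPf Ld) /=.
  have -> : j - i + 1 = - (i - j - 1) by ring.
  rewrite -![j - i]opprB !Omega_opp.
  move=> h1 h2.
  have {}h1 := h1 ltac:(lia) isT. have {}h2 := h2 ltac:(lia) isT.
  by apply: etrans (etrans (congr2 *%R h1 (esym h2)) _); ring.
have Omega_d k : Omega N L k d = Omega N L k 0.
  by rewrite !OmegaE add0r dvdz0 Ld (@dvdz_near L (d + 1) 1) // addrK.
have Omega_d1 k : Omega N L k (d - 1) = Omega N L k (- 1)%R.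
  rewrite !OmegaE subrK addNr dvdz0 Ld (@dvdz_near L (d - 1) (- 1)) //.
  by rewrite opprK subrK.
have xd k c : x k (m + 2 * d + c) = x k (m + c) by rewrite addrAC xn_eq.
rewrite !Omega_d !Omega_d1 dE !xd.
have [r0|r0] := boolP (N %| i - j)%Z; last exact: exchange_same_row.
rewrite (@xi_eq (i - 1) (j - 1)); last by rewrite opprB addrA subrK.
rewrite (@xi_eq (i + 1) (j + 1)); last by rewrite opprD addrACA subrr addr0.
rewrite !(@xi_eq i j _ r0).
(* For i = j modulo N the two sides differ only in these exponents. *)
suff [-> ->] : Omega N L (i - j + 1) (- 1)%R = Omega N L (i - j - 1) 0
  /\ Omega N L (i - j) (- 1)%R = Omega N L (i - j) 0 by [].
rewrite !OmegaE addNr add0r dvdz0 r0 addrK subrK r0.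
have -> : (L %| (- 1 : int))%Z = false by rewrite dvdzE dvdn1 gtn_eqF.
have -> : (L %| (1 : int))%Z = false by rewrite dvdzE dvdn1 gtn_eqF.
rewrite !addr0 !add0r.
have -> : (N %| i - j + 1)%Z = (N %| i - j - 1)%Z.
  rewrite (@dvdz_near N (i - j + 1) 1) ?addrK // (@dvdz_near N (i - j - 1) (- 1)).
    by rewrite rpredN.
  by rewrite opprK subrK.
by [].
Qed.
End Exchange.

(** * The map theta *)

Lemma conj_unit (D : unitRingType) (t a b : D) :
  t \is a GRing.unit -> t * a = b * t -> a \is a GRing.unit -> b \is a GRing.unit.
Proof. by move=> ut e ua; rewrite -(unitrMl b ut) -e unitrMr. Qed.

Lemma conj_inv (D : unitRingType) (t a b : D) :
  t \is a GRing.unit -> t * a = b * t -> a \is a GRing.unit -> t * a^-1 = b^-1 * t.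
Proof.
move=> ut tab ua; have ub := conj_unit ut tab ua.
by apply: (mulrI ub); rewrite mulVKr // mulrA -tab mulrK.
Qed.

Lemma even_pm (n : int) : ~~ even n -> even (n + 1) /\ even (n - 1).
Proof. by rewrite /even => on; split; lia. Qed.

Section Gfrac.
Variables (R : realType) (N L : nat) (q : R[i]).
Hypothesis hq : q != 0.

Lemma gfrac_ext (D : unitAlgType R[i]) (x x' : int -> int -> D) i n :
  (forall k, x k (n + 1) = x' k (n + 1)) -> (forall k, x k (n - 1) = x' k (n - 1)) ->
  gfrac q x i n = gfrac q x' i n.
Proof. by move=> h h'; rewrite /gfrac !h !h'. Qed.

Lemma gfrac_unit (D : unitAlgType R[i]) (x : int -> int -> D) i n :
  kappa_defined q x -> ~~ even n -> gfrac q x i n \is a GRing.unit.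
Proof.
move=> xd on; have en1 : even (n + 1) by rewrite /even in on *; lia.
have en2 : even (n - 1) by rewrite /even in on *; lia.
rewrite scaler_unit ?unitfE ?invr_eq0 ?expf_neq0 //.
have [[u1 w1] [u2 w2]] := (xd (i - 1) _ en1, xd i _ en1).
have [[u3 w3] [u4 w4]] := (xd (i + 1) _ en2, xd i _ en2).
have divU (a b : D) : a \is a GRing.unit -> b \is a GRing.unit -> a / b \is a GRing.unit.
  by move=> ua ub; rewrite unitrMl ?unitrV.
by rewrite unitrMl divU.
Qed.

Lemma gfrac_morph (K D : unitAlgType R[i]) (v : {lrmorphism K -> D})
    (x : int -> int -> K) i n :
  x i (n + 1) \is a GRing.unit -> x i (n - 1) \is a GRing.unit ->
  1 - q ^- 2 *: (x i (n + 1))^-1 \is a GRing.unit ->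
  1 - q ^- 2 *: (x i (n - 1))^-1 \is a GRing.unit ->
  v (gfrac q x i n) = gfrac q (fun k c => v (x k c)) i n.
Proof.
move=> u u' w w'; rewrite /gfrac linearZ /= !rmorphM /= (rmorphV _ w) (rmorphV _ w').
by rewrite !rmorphB !rmorph1 /= !linearZ /= !rmorphV.
Qed.

Lemma denom_conj (D : unitAlgType R[i]) (t a b : D) :
  t \is a GRing.unit -> t * a = b * t -> a \is a GRing.unit ->
  t * (1 - q ^- 2 *: a^-1) = (1 - q ^- 2 *: b^-1) * t.
Proof.
move=> ut tab ua.
by rewrite mulrBr mulrBl mulr1 mul1r -scalerAl -scalerAr (conj_inv ut tab).
Qed.

(** Conjugation by [t] acts on the fraction factor by factor; the unit hypotheses let it pass
    through the inverses. *)
Lemma gfrac_conj (D : unitAlgType R[i]) (t : D) (x x' : int -> int -> D) i n :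
  t \is a GRing.unit ->
  (forall k, t * x k (n + 1) = x' k (n + 1) * t) ->
  (forall k, t * x k (n - 1) = x' k (n - 1) * t) ->
  x i (n + 1) \is a GRing.unit -> x i (n - 1) \is a GRing.unit ->
  1 - q ^- 2 *: (x i (n + 1))^-1 \is a GRing.unit ->
  1 - q ^- 2 *: (x i (n - 1))^-1 \is a GRing.unit ->
  t * gfrac q x i n = gfrac q x' i n * t.
Proof.
move=> ut h h' u u' w w'.
have num k c : t * x k c = x' k c * t -> t * (1 - x k c) = (1 - x' k c) * t.
  by move=> e; rewrite mulrBr mulrBl e mulr1 mul1r.
have e := conj_inv ut (denom_conj ut (h i) u) w.
have e' := conj_inv ut (denom_conj ut (h' i) u') w'.
rewrite -scalerAr -scalerAl; congr (_ *: _).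
rewrite !mulrA num // -[in LHS](mulrA (1 - x' _ _)) e.
rewrite -!mulrA; congr (_ * (_ * _)).
by rewrite !mulrA num // -!mulrA e'.
Qed.

End Gfrac.

(** * The relations for the images of the generators under theta *)

Section Twist.
Variables (R : realType) (N L : nat) (q : R[i]) (D : unitAlgType R[i]).
Variable x : int -> int -> D.
Hypothesis hq : q != 0.
Hypothesis hL1 : (1 < L)%N \/ (forall i n : int, q ^ Omega N L i n = 1).
Hypothesis hx : Cq_generators N L q x.
Hypothesis xd : kappa_defined q x.

(** Lifts the even generators to a commutative algebra, where the exchange identity can be computed.
    Units must be reflected because that identity has denominators. *)
Lemma even_hull : exists (K : comUnitAlgType R[i]) (v : {lrmorphism K -> D})
    (X : int -> int -> K),
  [/\ forall u, v u \is a GRing.unit -> u \is a GRing.unit,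
      forall i n, even n -> v (X i n) = x i n,
      forall i n, X (i + N%:Z) n = X i n &
      forall i n, X i (n + 2 * L%:Z) = X i n].
Proof.
have [|K [v [vI vS vU]]] := @comm_hull _ D (fun a => exists i n, even n /\ a = x i n).
  move=> _ _ [i [n [en ->]]] [j [m [em ->]]].
  by apply: (cg_same_parity hx); rewrite /even in en em *; lia.
have pick (p : int * int) : {u | even p.2 -> v u = x p.1 p.2}.
  apply: cid; case: (boolP (even p.2)) => en; last by exists 0.
  by have [|u e] := vS (x p.1 p.2); [exists p.1, p.2 | exists u].
have [X vX] : {X : int -> int -> K | forall i n, even n -> v (X i n) = x i n}.
  by exists (fun i n => sval (pick (i, n))) => i n; apply: (svalP (pick (i, n))).
(* The value 0 at odd indices keeps both periodicities valid for all [n]. *)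
exists K, v, (fun i n => if even n then X i n else 0).
split=> // [i n en|i n|i n]; first by rewrite en vX.
  by case: ifP => // en; apply: vI; rewrite !vX // (cg_periodic_i hx).
have e2 : even (n + 2 * L%:Z) = even n by rewrite /even; lia.
by rewrite e2; case: ifP => // en; apply: vI; rewrite !vX ?e2 // (cg_periodic_n hx).
Qed.

Lemma inv_conj i n k c : ~~ even n -> even c ->
  (x i n)^-1 * x k c = conj_gens N L q x i n k c * (x i n)^-1.
Proof.
move=> on ec; have U := cg_unit hx i n.
apply: (mulrI U); rewrite mulVKr // /conj_gens -scalerAl -scalerAr mulrA.
apply: (mulIr U); rewrite -[in RHS]scalerAl mulrVK //.
rewrite (cg_even_odd hx) //; congr (q ^ _ *: _).
rewrite -Omega_opp; congr Omega; first by ring.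
by rewrite /even in on ec; lia.
Qed.

Lemma gfrac_comm_even i n k c : ~~ even n -> even c ->
  x k c * gfrac q x i n = gfrac q x i n * x k c.
Proof.
move=> on ec; have [en1 en2] := even_pm on.
apply: gfrac_conj; rewrite ?(cg_unit hx) //; try by apply: (xd _ _).2.
- by move=> l; apply: (cg_same_parity hx); rewrite /even in ec en1 *; lia.
- by move=> l; apply: (cg_same_parity hx); rewrite /even in ec en2 *; lia.
Qed.

(** Serves to move odd generators to the left of all fractions when two images under [theta] are
    multiplied. *)
Lemma gfrac_conj_odd i n j m : ~~ even n -> ~~ even m ->
  gfrac q x j m * x i n = x i n * gfrac q (conj_gens N L q x i n) j m.
Proof.
move=> on om; have [em1 em2] := even_pm om; have U := cg_unit hx i n.
have H : (x i n)^-1 * gfrac q x j m = gfrac q (conj_gens N L q x i n) j m * (x i n)^-1.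
  apply: gfrac_conj; rewrite ?unitrV ?(cg_unit hx) //.
  - by move=> k; apply: inv_conj.
  - by move=> k; apply: inv_conj.
  - by have [] := xd j em1.
  - by have [] := xd j em2.
by apply: (mulrI (_ : (x i n)^-1 \is a GRing.unit)); rewrite ?unitrV // mulrA H mulrVK // mulKr.
Qed.

Lemma gfrac_exchange i n j m : ~~ even n -> ~~ even m ->
  gfrac q x i n * gfrac q (conj_gens N L q x i n) j m =
  gfrac q x j m * gfrac q (conj_gens N L q x j m) i n /\
  gfrac q x i n * gfrac q (conj_gens N L q x i n) j m =
  gfrac q (conj_gens N L q x i n) j m * gfrac q x i n.
Proof.
have [K [v [X [vU vX Xi Xn]]]] := even_hull.
have XU k c : even c -> X k c \is a GRing.unit.
  by move=> ec; apply: vU; rewrite vX // (cg_unit hx).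
have X1 k c : even c -> 1 - X k c \is a GRing.unit.
  by move=> ec; apply: vU; rewrite rmorphB rmorph1 /= vX //; have [] := xd k ec.
have Xq k c : even c -> 1 - q ^- 2 *: (X k c)^-1 \is a GRing.unit.
  move=> ec; apply: vU; rewrite rmorphB rmorph1 /= linearZ /= rmorphV ?XU //= vX //.
  by have [] := xd k ec.
have gX k c : ~~ even c -> gfrac q x k c = v (gfrac q X k c).
  move=> oc; have [ec1 ec2] := even_pm oc; rewrite gfrac_morph ?XU ?Xq //.
  by apply: gfrac_ext => l; rewrite vX.
have vW k c l d : even d -> v (conj_gens N L q X k c l d) = conj_gens N L q x k c l d.
  by move=> ed; rewrite linearZ /= vX.
have WU k c l d : even d -> conj_gens N L q X k c l d \is a GRing.unit.
  by move=> ed; rewrite scaler_unit ?XU // unitfE expfz_neq0.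
(* The rescaled denominators are conjugates of the original ones by an inverse odd generator, hence
   units. *)
have Wq k c l d : ~~ even c -> even d ->
    1 - q ^- 2 *: (conj_gens N L q X k c l d)^-1 \is a GRing.unit.
  move=> oc ed; apply: vU; rewrite rmorphB rmorph1 /= linearZ /= rmorphV ?WU //= vW //.
  have U : (x k c)^-1 \is a GRing.unit by rewrite unitrV (cg_unit hx).
  apply: (conj_unit U) (denom_conj _ U (inv_conj _ _ oc ed) _) _.
    exact: cg_unit hx _ _.
  by have [] := xd l ed.
have gW k c l d : ~~ even c -> ~~ even d ->
    gfrac q (conj_gens N L q x k c) l d = v (gfrac q (conj_gens N L q X k c) l d).
  move=> oc od; have [ed1 ed2] := even_pm od; rewrite gfrac_morph ?WU ?Wq //.
  by apply: gfrac_ext => m'; rewrite vW.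
move=> on om; rewrite !gX // !gW // -!rmorphM; split; congr (v _); last exact: mulrC.
exact: gfrac_exchange_comm.
Qed.

(* [theta false] is the theta of the header and [theta true] its inverse theta'. *)
Definition theta (b : bool) (i n : int) : D :=
  if even n then x i n else
  x i n * (if b then gfrac q x i n else (gfrac q x i n)^-1).

Lemma theta_unit b i n : theta b i n \is a GRing.unit.
Proof.
rewrite /theta; case: ifP => [_|/negbT on]; first exact: cg_unit hx _ _.
by rewrite unitrMr ?(cg_unit hx) //; case: b; rewrite ?unitrV gfrac_unit.
Qed.

(** An odd image is an odd generator times an element commuting with all even generators, so the
    essential case is the product of two odd images. *)
Lemma theta_gens b : Cq_generators N L q (theta b).
Proof.
have g_i i n : gfrac q x (i + N%:Z) n = gfrac q x i n.
  by rewrite /gfrac ![i + N%:Z + _]addrAC !(cg_periodic_i hx).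
have g_n i n : gfrac q x i (n + 2 * L%:Z) = gfrac q x i n.
  by rewrite /gfrac ![n + 2 * L%:Z + _]addrAC !(cg_periodic_n hx).
split=> [i n|i n|i n|i j n m enm|i j n m en om].
- by rewrite /theta (cg_periodic_i hx) g_i.
- have e2 : even (n + 2 * L%:Z) = even n by rewrite /even; lia.
  by rewrite /theta e2 (cg_periodic_n hx) g_n.
- exact: theta_unit.
- have enE : even n = even m by rewrite /even in enm *; lia.
  rewrite /theta enE; case: ifP => [em|/negbT om]; first exact: cg_same_parity hx _ _ _ _ enm.
  have on : ~~ even n by rewrite enE.
  have Ui := gfrac_unit hq i xd on; have Uj := gfrac_unit hq j xd om.
  have [xij _] := gfrac_exchange i j on om.
  have [_ ci] := gfrac_exchange i j on om; have [_ cj] := gfrac_exchange j i om on.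
  have hi := gfrac_conj_odd j i om on; have hj := gfrac_conj_odd i j on om.
  case: b.
    (* With [x i n] and [x j m] moved to the left, what remains is [gfrac_exchange], its factors
       reordered by [ci] and [cj]. *)
    rewrite -!mulrA [gfrac q x i n * _]mulrA hi [gfrac q x j m * _]mulrA hj.
    rewrite !mulrA (cg_same_parity hx) // -!mulrA; congr (_ * (_ * _)).
    by rewrite -cj -ci.
  (* The same scheme for the inverse fractions, ending with the exchange identity in inverted
     form. *)
  have inv_odd (a y g : D) : a \is a GRing.unit -> y \is a GRing.unit -> a * y = y * g ->
      g \is a GRing.unit /\ a^-1 * y = y * g^-1.
    move=> ua uy e; have ug : g \is a GRing.unit.
      by rewrite -(unitrMr g uy) -e unitrMl.
    by split=> //; apply: (mulrI ua); rewrite mulVKr // mulrA e mulrK.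
  have [ui hi'] := inv_odd _ _ _ Ui (cg_unit hx j m) hi.
  have [uj hj'] := inv_odd _ _ _ Uj (cg_unit hx i n) hj.
  rewrite -!mulrA [(gfrac q x i n)^-1 * _]mulrA hi' [(gfrac q x j m)^-1 * _]mulrA hj'.
  rewrite !mulrA (cg_same_parity hx) // -!mulrA; congr (_ * (_ * _)).
  by rewrite -!invrM // xij.
- rewrite /theta en (negPf om).
  have c : x i n * (if b then gfrac q x j m else (gfrac q x j m)^-1) =
      (if b then gfrac q x j m else (gfrac q x j m)^-1) * x i n.
    case: b; first exact: gfrac_comm_even.
    by apply: conj_inv; rewrite ?(cg_unit hx) ?gfrac_unit // gfrac_comm_even.
  by rewrite mulrA (cg_even_odd hx) // -scalerAl -!mulrA c.
Qed.

End Twist.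

(** * Fractions and generators *)

Lemma lrmorphism_pack (F : fieldType) (A B : unitAlgType F) (f : A -> B) :
  linear f -> monoid_morphism f -> exists g : {lrmorphism A -> B}, g =1 f.
Proof.
move=> lf mf.
pose g : {lrmorphism A -> B} := HB.pack f
  (GRing.isLinear.Build F A B *:%R f lf) (GRing.isMonoidMorphism.Build A B f mf).
by exists g.
Qed.

Section Fractions.
Variables (R : realType) (C D : unitAlgType R[i]) (iota : {lrmorphism C -> D}).
Hypothesis fr : is_fractions iota.

Lemma iota_inj : injective iota.
Proof.
move=> a b e; apply/eqP; rewrite -subr_eq0; apply/negPn/negP => /fr.1.
by rewrite rmorphB /= e subrr unitr0.
Qed.

(** The right Ore condition, obtained by writing the left fraction of [a] by [b] as a right
    fraction. *)
Lemma common_multiple (a b : C) : b != 0 -> exists a' b', b' != 0 /\ a * b' = b * a'.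
Proof.
move=> b0; have [c [d [d0 e]]] := fr.2 ((iota b)^-1 * iota a).
exists c, d; split=> //; apply: iota_inj; rewrite !rmorphM /=.
have ub := fr.1 _ b0; have ud := fr.1 _ d0.
have uV : (iota b)^-1 \is a GRing.unit by rewrite unitrV.
by apply: (mulrI uV); rewrite mulrA e mulrVK // mulKr.
Qed.

Lemma mul_neq0 (a b : C) : a != 0 -> b != 0 -> a * b != 0.
Proof.
move=> a0 b0; apply/eqP => ab; have: iota (a * b) \is a GRing.unit.
  by rewrite rmorphM unitrMl fr.1.
by rewrite ab rmorph0 unitr0.
Qed.

Lemma lrmorphism_frac_eq (B : unitAlgType R[i]) (G H : {lrmorphism D -> B}) :
  (forall a, G (iota a) = H (iota a)) -> G =1 H.
Proof.
move=> GH d; have [a [b [b0 ->]]] := fr.2 d.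
by rewrite !rmorphM /= !rmorphV ?fr.1 //= !GH.
Qed.

(** Universal property of the localization. Well-definedness and additivity use common denominators
    from the Ore condition. *)
Lemma extend_frac (B : unitAlgType R[i]) (h : {lrmorphism C -> B}) :
  (forall a, a != 0 -> h a \is a GRing.unit) ->
  exists H : {lrmorphism D -> B}, forall a, H (iota a) = h a.
Proof.
move=> hU.
(* H d = h a / h b for d = iota a / iota b, phrased without inverses. *)
pose graph d e := exists a b, [/\ b != 0, d * iota b = iota a & e * h b = h a].
have graph_fun d e e' : graph d e -> graph d e' -> e = e'.
  move=> [a [b [b0 da ea]]] [a' [b' [b'0 da' ea']]].
  have [c' [c [c0 bc]]] := common_multiple b b'0.
  have ac : a * c = a' * c'.
    by apply: iota_inj; rewrite !rmorphM /= -da -da' -!mulrA -!rmorphM bc.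
  have U : h (b * c) \is a GRing.unit by apply/hU/mul_neq0.
  apply: (mulIr U); rewrite [in RHS]bc !rmorphM /= !mulrA ea ea' -!rmorphM.
  by rewrite ac.
have graph_ex d : {e | graph d e}.
  apply: cid; have [a [b [b0 ->]]] := fr.2 d.
  by exists (h a / h b), a, b; rewrite !mulrVK ?fr.1 ?hU.
pose H d := sval (graph_ex d).
have HP d : graph d (H d) by apply: svalP (graph_ex d).
have Hl : linear H.
  move=> k d d'; apply: graph_fun (HP _) _.
  have [a [b [b0 da ea]]] := HP d; have [a' [b' [b'0 da' ea']]] := HP d'.
  have [c' [c [c0 bc]]] := common_multiple b b'0.
  exists (k *: (a * c) + a' * c'), (b * c); split; first exact: mul_neq0.
    rewrite mulrDl -scalerAl {2}bc !rmorphM /= !mulrA da da'.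
    by rewrite linearP !rmorphM.
  by rewrite mulrDl -scalerAl {2}bc !rmorphM /= !mulrA ea ea' linearP !rmorphM.
have Hm : monoid_morphism H.
  split=> [|d d'].
    by apply: graph_fun (HP _) _; exists 1, 1; rewrite !rmorph1 !mulr1 oner_neq0.
  apply: graph_fun (HP _) _.
  have [a [b [b0 da ea]]] := HP d; have [a' [b' [b'0 da' ea']]] := HP d'.
  (* For a product, [b] is moved past the numerator [a']: (a / b)(a' / b') becomes (a c') / (b'
     c). *)
  have [c' [c [c0 bc]]] := common_multiple a' b0.
  exists (a * c'), (b' * c); split; first exact: mul_neq0.
    by rewrite !rmorphM /= -mulrA (mulrA d') da' -rmorphM bc !rmorphM /= mulrA da.
  by rewrite !rmorphM /= -mulrA (mulrA (H d')) ea' -rmorphM bc !rmorphM /= mulrA ea.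
have [G GH] := lrmorphism_pack Hl Hm; exists G => a; rewrite GH.
apply: graph_fun (HP _) _; exists a, 1.
by rewrite !rmorph1 !mulr1 oner_neq0.
Qed.

End Fractions.

(** * Families of generators and the universal algebra *)

Section Generators.
Variables (R : realType) (N L : nat) (q : R[i]).

Lemma image_gens (A B : unitAlgType R[i]) (f : {lrmorphism A -> B}) x :
  Cq_generators N L q x -> Cq_generators N L q (fun i n => f (x i n)).
Proof.
move=> hx; split=> [i n|i n|i n|i j n m e|i j n m e o].
- by rewrite (cg_periodic_i hx).
- by rewrite (cg_periodic_n hx).
- exact/rmorph_unit/(cg_unit hx).
- by rewrite -!rmorphM (cg_same_parity hx).
- by rewrite -!rmorphM /= (cg_even_odd hx) // linearZ.
Qed.

Lemma scale_gens (A : unitAlgType R[i]) (k : R[i]) (x : int -> int -> A) :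
  k != 0 -> Cq_generators N L q x -> Cq_generators N L q (fun i n => k *: x i n).
Proof.
move=> k0 hx; split=> [i n|i n|i n|i j n m e|i j n m e o].
- by rewrite (cg_periodic_i hx).
- by rewrite (cg_periodic_n hx).
- by rewrite scaler_unit ?unitfE // (cg_unit hx).
- by rewrite -!scalerAl -!scalerAr (cg_same_parity hx).
- rewrite -!scalerAl -!scalerAr (cg_even_odd hx) // !scalerA; congr (_ *: _).
  by ring.
Qed.

(** [flip false s] gives the images of the generators under the T of the header, [flip true (- s)]
    those under its inverse. *)
Definition flip (A : unitAlgType R[i]) (b : bool) (s : int) (u : int -> int -> A)
    (i n : int) : A :=
  if even n == b then u i (n + s) else (u i (n + s))^-1.

(** An odd shift exchanges the parities and so reverses the relation between even and odd
    generators; inverting one of the two classes reverses it back. *)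
Lemma flip_gens (A : unitAlgType R[i]) b s (u : int -> int -> A) :
  ~~ even s -> Cq_generators N L q u -> Cq_generators N L q (flip b s u).
Proof.
move=> os hu; have uU := cg_unit hu.
split=> [i n|i n|i n|i j n m e|i j n m en om].
- by rewrite /flip (cg_periodic_i hu).
- have e2 : even (n + 2 * L%:Z) = even n by rewrite /even; lia.
  by rewrite /flip e2 addrAC (cg_periodic_n hu).
- by rewrite /flip; case: ifP => _; rewrite ?unitrV uU.
- have c : u i (n + s) * u j (m + s) = u j (m + s) * u i (n + s).
    by apply: (cg_same_parity hu); rewrite opprD addrACA subrr addr0.
  have -> : flip b s u i n = if even m == b then u i (n + s) else (u i (n + s))^-1.
    by have en : even n = even m by [rewrite /even in e *; lia]; rewrite /flip en.
  rewrite /flip; case: ifP => _ //.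
  by rewrite -!invrM // c.
- have en' : ~~ even (n + s) by rewrite /even in en os *; lia.
  have em' : even (m + s) by rewrite /even in om os *; lia.
  have c : u j (m + s) * u i (n + s) =
      q ^ Omega N L (i - j) ((n - m - 1) %/ 2)%Z *: (u i (n + s) * u j (m + s)).
    rewrite (cg_even_odd hu) // -[in RHS]Omega_opp; congr (q ^ _ *: _).
    by congr Omega; [ring | rewrite /even in en om; lia].
  rewrite /flip en (negPf om); case: b.
    apply: (mulrI (uU j (m + s))); rewrite mulrA c -!scalerAl -scalerAr.
    by rewrite mulrK // mulVKr.
  apply: (mulrI (uU i (n + s))); rewrite /= mulVKr //.
  by apply: (mulIr (uU i (n + s))); rewrite -scalerAr -scalerAl c mulrA mulrVK.
Qed.

Variables (C : unitAlgType R[i]) (chi : int -> int -> C).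
Hypothesis hC : is_Cq N L q chi.

Lemma lrmorphism_gens_eq (B : unitAlgType R[i]) (g h : {lrmorphism C -> B}) :
  (forall i n, g (chi i n) = h (chi i n)) -> g =1 h.
Proof.
move=> gh a; have [f [_ fu]] := hC.2 _ _ (image_gens h hC.1).
by rewrite (fu g) // -(fu h).
Qed.

(** Induction on [C] from universality: the subalgebra [S] contains a family satisfying the
    relations, so [C] maps to it, and composing with the inclusion fixes the generators. *)
Lemma generated (S : C -> Prop) :
  S 1 -> (forall a b, S a -> S b -> S (a + b)) ->
  (forall a b, S a -> S b -> S (a * b)) -> (forall k a, S a -> S (k *: a)) ->
  (forall i n, S (chi i n)) -> (forall i n, S (chi i n)^-1) -> forall a, S a.
Proof.
move=> S1 SD SM SZ Sx Sxi a; have hx := hC.1.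
have [B [v [vI vS Sv vU]]] := subalg_type S1 SD SM SZ.
pose y i n := sval (cid (Sv _ (Sx i n))).
have vy i n : v (y i n) = chi i n by apply: (svalP (cid (Sv _ (Sx i n)))).
have hy : Cq_generators N L q y.
  split=> [i n|i n|i n|i j n m e|i j n m e o].
  - by apply: vI; rewrite !vy (cg_periodic_i hx).
  - by apply: vI; rewrite !vy (cg_periodic_n hx).
  - have [w vw] := Sv _ (Sxi i n).
    by apply: (vU _ w); rewrite vy vw ?mulrV ?mulVr ?(cg_unit hx).
  - by apply: vI; rewrite !rmorphM /= !vy (cg_same_parity hx).
  - by apply: vI; rewrite linearZ !rmorphM /= !vy (cg_even_odd hx).
have [f [fy _]] := hC.2 _ _ hy.
have -> : a = (v \o f) a.
  apply: (@lrmorphism_gens_eq _ idfun (v \o f)) => i n.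
  by rewrite /= fy vy.
exact: vS.
Qed.

(* The relations are homogeneous, so chi |-> 2 chi defines an endomorphism of C,
   which would have to fix chi i n if it were a scalar. *)
Lemma chi_neq_scalar i n k : k *: 1 != chi i n.
Proof.
apply/eqP => e; have n2 : (2 : R[i]) != 0 by rewrite pnatr_eq0.
have [f [fx _]] := hC.2 _ _ (scale_gens n2 hC.1).
have := fx i n; rewrite -e linearZ /= rmorph1 => /eqP.
rewrite scaler_nat mulr2n -subr_eq0 opprD addNKr oppr_eq0 e => /eqP c0.
by have := cg_unit hC.1 i n; rewrite c0 unitr0.
Qed.

(** Nonzero elements of [C] become invertible in [D], and the vanishing of either expression would
    make [chi i n] a scalar. *)
Lemma fractions_kappa_defined (D : unitAlgType R[i]) (iota : {lrmorphism C -> D}) :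
  q != 0 -> is_fractions iota -> kappa_defined q (fun i n => iota (chi i n)).
Proof.
move=> hq fr i n en; have U := cg_unit hC.1 i n.
have -> : 1 - iota (chi i n) = iota (1 - chi i n) by rewrite rmorphB rmorph1.
have -> : 1 - q ^- 2 *: (iota (chi i n))^-1 = iota (1 - q ^- 2 *: (chi i n)^-1).
  by rewrite -(rmorphV iota U) /= -[q ^- 2 *: iota _]linearZ rmorphB rmorph1.
split; apply: fr.1.
  by rewrite subr_eq0 -[X in X != _]scale1r (chi_neq_scalar i n 1).
rewrite subr_eq0; apply/eqP => e; have /eqP[] := chi_neq_scalar i n (q ^- 2).
by have := congr1 ( *%R^~ (chi i n)) e; rewrite /= mul1r -scalerAl mulVr.
Qed.

End Generators.

(** * Injectivity *)

(** The algebra E of the header, in a form that gives induction over its elements. *)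
Inductive even_part (R : realType) (C : unitAlgType R[i]) (chi : int -> int -> C) :
  C -> Prop :=
| even_part_scalar k : even_part chi k%:A
| even_part_gen i n : even n -> even_part chi (chi i n)
| even_part_inv i n : even n -> even_part chi (chi i n)^-1
| even_partD a b : even_part chi a -> even_part chi b -> even_part chi (a + b)
| even_partM a b : even_part chi a -> even_part chi b -> even_part chi (a * b).

Section Injectivity.
Variables (R : realType) (N L : nat) (q : R[i]).
Variables (C D : unitAlgType R[i]) (chi : int -> int -> C).
Variable iota : {lrmorphism C -> D}.
Hypothesis hq : q != 0.
Hypothesis hL1 : (1 < L)%N \/ (forall i n : int, q ^ Omega N L i n = 1).
Hypothesis hC : is_Cq N L q chi.
Hypothesis fr : is_fractions iota.

Local Notation x := (fun i n => iota (chi i n)).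
Local Notation E := (even_part chi).
Local Notation g := (gfrac q x).

Let chiU i n : chi i n \is a GRing.unit. Proof. exact: cg_unit hC.1 i n. Qed.
Let xU i n : iota (chi i n) \is a GRing.unit. Proof. exact: rmorph_unit. Qed.
Let xd : kappa_defined q x. Proof. exact (fractions_kappa_defined hC hq fr). Qed.
Let hx : Cq_generators N L q x. Proof. exact: image_gens hC.1. Qed.

Lemma even_part1 : E 1. Proof. by rewrite -(scale1r 1); apply: even_part_scalar. Qed.

Lemma even_partZ k a : E a -> E (k *: a).
Proof. by move=> Ea; rewrite -mulr_algl; apply: even_partM => //; apply: even_part_scalar. Qed.

Lemma even_part_comm a b : E a -> E b -> a * b = b * a.
Proof.
have inv_comm (u v : C) : u \is a GRing.unit -> v * u = u * v -> v * u^-1 = u^-1 * v.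
  by move=> uu uv; apply: (mulrI uu); rewrite mulVKr // mulrA -uv mulrK.
have gen_comm i n c : even n -> E c -> c * chi i n = chi i n * c.
  move=> en; elim=> [k|j m em|j m em|u v _ hu _ hv|u v _ hu _ hv].
  - by rewrite mulr_algl mulr_algr.
  - by apply: (cg_same_parity hC.1); rewrite /even in en em *; lia.
  - apply/esym/inv_comm => //.
    by apply: (cg_same_parity hC.1); rewrite /even in en em *; lia.
  - by rewrite mulrDl mulrDr hu hv.
  - by rewrite -mulrA hv mulrA hu mulrA.
move=> Ea; elim=> [k|i n en|i n en|u v _ hu _ hv|u v _ hu _ hv].
- by rewrite mulr_algl mulr_algr.
- exact: gen_comm.
- by apply: inv_comm; rewrite // gen_comm.
- by rewrite mulrDl mulrDr hu hv.
- by rewrite mulrA hu -mulrA hv mulrA.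
Qed.

(** Conjugation by an odd generator rescales each even generator by a nonzero power of q; an even
    generator commutes with all of E. *)
Lemma even_part_conj i n a : E a ->
  E (chi i n * a * (chi i n)^-1) /\ E ((chi i n)^-1 * a * chi i n).
Proof.
have conjM t (tU : t \is a GRing.unit) (u v : C) :
    t * (u * v) * t^-1 = t * u * t^-1 * (t * v * t^-1).
  by rewrite !mulrA mulrVK.
have sub t : t \is a GRing.unit ->
    (forall j m, even m -> exists2 k : R[i], k != 0 & t * chi j m * t^-1 = k *: chi j m) ->
    E a -> E (t * a * t^-1).
  move=> tU tx; elim=> [k|j m em|j m em|u v _ hu _ hv|u v _ hu _ hv].
  - by rewrite mulr_algr -scalerAl mulrV //; apply: even_part_scalar.
  - by have [k _ ->] := tx j _ em; apply/even_partZ/even_part_gen.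
  - have [k k0 e] := tx j _ em.
    have -> : t * (chi j m)^-1 * t^-1 = (t * chi j m * t^-1)^-1.
      by rewrite !invrM ?unitrV ?unitrMl ?unitrV // invrK mulrA.
    by rewrite e invrZ ?unitfE //; apply/even_partZ/even_part_inv.
  - by rewrite mulrDr mulrDl; apply: even_partD.
  - by rewrite conjM //; apply: even_partM.
move=> Ea; have [en|on] := boolP (even n).
  have c := even_part_comm Ea (even_part_gen chi i en).
  by rewrite -c mulrK // -mulrA c mulKr.
split.
  apply: sub => // j m em.
  have c := cg_even_odd hC.1 j i em on.
  exists (q ^ Omega N L (j - i) ((m - n - 1) %/ 2)%Z)^-1; first by rewrite invr_eq0 expfz_neq0.
  have k0 : q ^ Omega N L (j - i) ((m - n - 1) %/ 2)%Z != 0 by rewrite expfz_neq0.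
  by rewrite -[chi i n * _](scalerK k0) -c -scalerAl mulrK.
rewrite -[X in _ * _ * X]invrK; apply: sub; rewrite ?unitrV // => j m em.
exists (q ^ Omega N L (j - i) ((m - n - 1) %/ 2)%Z); first by rewrite expfz_neq0.
by rewrite invrK -mulrA (cg_even_odd hC.1) // -scalerAr mulKr.
Qed.

(** For odd [n] the numerators and denominators lie in the commutative algebra E, so the
    denominators can be cleared together. *)
Lemma gfrac_ratio i n : ~~ even n -> exists m l : C,
  [/\ E m, E l, m != 0, l != 0 & g i n * iota l = iota m].
Proof.
move=> on; have [e1 e2] := even_pm on.
pose den c := 1 - q ^- 2 *: (chi i c)^-1; pose num j c := 1 - chi j c.
have E1B c : E c -> E (1 - c).
  move=> Ec; apply: even_partD; first exact: even_part1.
  by rewrite -scaleN1r; apply: even_partZ.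
have Eden c : even c -> E (den c) by move=> ec; apply/E1B/even_partZ/even_part_inv.
have Enum j c : even c -> E (num j c) by move=> ec; apply/E1B/even_part_gen.
have iden c : iota (den c) = 1 - q ^- 2 *: (iota (chi i c))^-1.
  by rewrite -(rmorphV iota (chiU i c)) /= -[q ^- 2 *: iota _]linearZ rmorphB rmorph1.
have inum j c : iota (num j c) = 1 - iota (chi j c) by rewrite rmorphB rmorph1.
have nz a : iota a \is a GRing.unit -> a != 0.
  by move=> u; apply/eqP => a0; move: u; rewrite a0 rmorph0 unitr0.
have dU c : even c -> iota (den c) \is a GRing.unit.
  by move=> ec; rewrite iden; have [] := xd i ec.
have lU : iota (den (n - 1) * den (n + 1)) \is a GRing.unit.
  by rewrite rmorphM unitrMl dU.
have eq : g i n * iota (den (n - 1) * den (n + 1)) =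
    iota (q ^- 2 *: (num (i - 1) (n + 1) * num (i + 1) (n - 1))).
  rewrite linearZ /= !rmorphM /= /gfrac -!iden -!inum -scalerAl; congr (_ *: _).
  rewrite -!mulrA (mulKr (dU _ e2)) -!rmorphM (even_part_comm (Enum _ _ e2) (Eden _ e1)).
  by rewrite !rmorphM /= mulKr ?dU.
exists (q ^- 2 *: (num (i - 1) (n + 1) * num (i + 1) (n - 1))).
exists (den (n - 1) * den (n + 1)); split=> //.
- by apply/even_partZ/even_partM; apply: Enum.
- by apply: even_partM; apply: Eden.
- by apply: nz; rewrite -eq unitrMl // gfrac_unit.
- exact: nz.
Qed.

Variable th : bool -> {lrmorphism C -> D}.
Hypothesis th_chi : forall b i n, th b (chi i n) = theta q x b i n.

Lemma th_even b a : E a -> th b a = iota a.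
Proof.
elim=> [k|i n en|i n en|u v _ hu _ hv|u v _ hu _ hv].
- by rewrite !linearZ /= !rmorph1.
- by rewrite th_chi /theta en.
- by rewrite !rmorphV //= th_chi /theta en.
- by rewrite !rmorphD /= hu hv.
- by rewrite !rmorphM /= hu hv.
Qed.

(** An Ore condition that keeps the new denominator in E. For a generator t it is [t^-1 * e * t];
    sums use the commutativity of E, and products apply the condition twice. *)
Lemma even_part_ore a e : E e -> e != 0 ->
  exists a' e', [/\ E e', e' != 0 & a * e' = e * a'].
Proof.
move: a e; apply: (generated hC) => [|a b ha hb|a b ha hb|k a ha|i n|i n] e Ee e0.
- by exists 1, e; rewrite mul1r mulr1.
- have [a' [ea [Ea ea0 ha']]] := ha e Ee e0.
  have [b' [eb [Eb eb0 hb']]] := hb e Ee e0.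
  exists (a' * eb + b' * ea), (ea * eb); split; first exact: even_partM.
    exact: (mul_neq0 fr).
  by rewrite mulrDl mulrDr mulrA ha' (even_part_comm Ea Eb) mulrA hb' !mulrA.
- have [a' [ea [Ea ea0 ha']]] := ha e Ee e0.
  have [b' [eb [Eb eb0 hb']]] := hb ea Ea ea0.
  by exists (a' * b'), eb; split=> //; rewrite -mulrA hb' !mulrA ha'.
- have [a' [ea [Ea ea0 ha']]] := ha e Ee e0.
  by exists (k *: a'), ea; split=> //; rewrite -scalerAl ha' scalerAr.
- exists (chi i n), ((chi i n)^-1 * e * chi i n); split; first exact: (even_part_conj i n Ee).2.
    apply: contra_neq e0 => h; apply: (mulrI (_ : (chi i n)^-1 \is a GRing.unit)).
      by rewrite unitrV.
    by apply: (mulIr (chiU i n)); rewrite h mulr0 mul0r.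
  by rewrite !mulrA mulrV ?chiU ?mul1r.
- exists (chi i n)^-1, (chi i n * e * (chi i n)^-1); split; first exact: (even_part_conj i n Ee).1.
    apply: contra_neq e0 => h; apply: (mulrI (chiU i n)).
    apply: (mulIr (_ : (chi i n)^-1 \is a GRing.unit)); first by rewrite unitrV.
    by rewrite h mulr0 mul0r.
  by rewrite !mulrA mulVr ?chiU ?mul1r.
Qed.

Lemma th_inj b a : th b a = 0 -> a = 0.
Proof.
(* P is the graph of the extension of [th (~~ b)] to the localization at E. *)
pose P d d' := exists c e,
  [/\ E e, e != 0, d * iota e = iota c & d' * iota e = th (~~ b) c].
have P_th c : P (th b c) (iota c).
  have gU i n : ~~ even n -> g i n \is a GRing.unit by move=> on; apply: gfrac_unit.
  pose gb b i n := if b then g i n else (g i n)^-1.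
  have ratio b' i n : ~~ even n -> exists m l : C, [/\ E m, E l, m != 0, l != 0 &
      [/\ gb b' i n * iota l = iota m, iota l * gb b' i n = iota m &
          gb (~~ b') i n * iota m = iota l]].
    move=> on; have [m [l [Em El m0 l0 e]]] := gfrac_ratio i on.
    have lU := fr.1 _ l0; have mU := fr.1 _ m0.
    have e' : (g i n)^-1 * iota m = iota l by rewrite -e mulKr ?gU.
    have cml := even_part_comm Em El.
    rewrite /gb; case: b'; [exists m, l | exists l, m]; split=> //; split=> //.
      by apply: (mulIr lU); rewrite -mulrA e -!rmorphM cml.
    by apply: (mulIr mU); rewrite -mulrA e' -!rmorphM cml.
  apply: (generated hC (S := fun c => P (th b c) (iota c))) => [|u v|u v|k u|i n|i n].
  - by exists 1, 1; rewrite !rmorph1 !mulr1 oner_neq0; split=> //; apply: even_part1.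
  - move=> [c1 [e1 [E1 e10 d1 d1']]] [c2 [e2 [E2 e20 d2 d2']]].
    exists (c1 * e2 + c2 * e1), (e1 * e2); split; first exact: even_partM.
    + exact: (mul_neq0 fr).
    + rewrite !rmorphD !mulrDl !rmorphM /= mulrA d1 -!rmorphM.
      by rewrite (even_part_comm E1 E2) !rmorphM /= mulrA d2.
    + rewrite !rmorphD !mulrDl !rmorphM /= !mulrA d1' (th_even _ E1) (th_even _ E2).
      by rewrite -[iota v * _ * _]mulrA -rmorphM (even_part_comm E1 E2) rmorphM /= mulrA d2'.
  - move=> [c1 [e1 [E1 e10 d1 d1']]] [c2 [e2 [E2 e20 d2 d2']]].
    have [c3 [e3 [E3 e30 c23]]] := even_part_ore c2 E1 e10.
    exists (c1 * c3), (e2 * e3); split; first exact: even_partM.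
    + exact: (mul_neq0 fr).
    + rewrite !rmorphM /= -mulrA [th b v * _]mulrA d2 -rmorphM c23 rmorphM /=.
      by rewrite mulrA d1.
    + rewrite !rmorphM /= -mulrA [iota v * _]mulrA d2' -(th_even (~~ b) E3).
      by rewrite -rmorphM c23 rmorphM /= (th_even _ E1) mulrA d1'.
  - move=> [c1 [e1 [E1 e10 d1 d1']]]; exists (k *: c1), e1.
    by rewrite !linearZ /= -!scalerAl d1 d1'.
  - rewrite th_chi /theta; case: ifP => [en|/negbT on].
      exists (chi i n), 1; rewrite !rmorph1 !mulr1 oner_neq0 th_chi /theta en.
      by split=> //; apply: even_part1.
    have [m [l [Em El m0 l0 [e e' e'']]]] := ratio b i n on.
    (* The image is [chi i n] times m / l; its numerator [chi i n * m] is sent by [th (~~ b)] to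
       [chi i n * l]. *)
    exists (chi i n * m), l; rewrite !rmorphM /= -mulrA e; split=> //.
    by rewrite th_chi /theta (negPf on) th_even // -mulrA -e''.
  - rewrite !rmorphV //= th_chi /theta; case: ifP => [en|/negbT on].
      exists (chi i n)^-1, 1; rewrite !rmorph1 !mulr1 oner_neq0 !rmorphV //= th_chi /theta en.
      by split=> //; apply: even_part1.
    have [m [l [Em El m0 l0 [e e' e'']]]] := ratio b i n on.
    have gbU b' : gb b' i n \is a GRing.unit by rewrite /gb; case: b'; rewrite ?unitrV gU.
    have gbV b' : (gb b' i n)^-1 = gb (~~ b') i n by rewrite /gb; case: b'; rewrite ?invrK.
    (* The image is l / m times the inverse of [chi i n]; moving the denominator [m] to the right
       conjugates it, which keeps it in E. *)
    exists (l * (chi i n)^-1), (chi i n * m * (chi i n)^-1); split.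
    + exact: (even_part_conj i n Em).1.
    + apply: contra_neq m0 => h; apply: (mulrI (chiU i n)).
      apply: (mulIr (_ : (chi i n)^-1 \is a GRing.unit)); first by rewrite unitrV.
      by rewrite h mulr0 mul0r.
    + by rewrite invrM ?gbU // gbV !rmorphM /= !rmorphV //= -!mulrA mulKr ?xU // mulrA -e''.
    + rewrite !rmorphM /= !rmorphV //= th_even // th_chi /theta (negPf on).
      rewrite -[if ~~ b then _ else _]/(gb (~~ b) i n) -(gbV b) invrM ?unitrV ?gbU //.
      by rewrite invrK [RHS]mulrA e' -!mulrA mulKr ?xU.
move=> ta; have [c [e [Ee e0 h h']]] := P_th a.
(* A zero image forces the numerator [c] to vanish, and with it [iota a]. *)
have c0 : c = 0 by apply: (iota_inj fr); rewrite -h ta mul0r rmorph0.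
apply: (iota_inj fr); apply: (mulIr (fr.1 _ e0)).
by rewrite h' c0 !rmorph0 mul0r.
Qed.

End Injectivity.

(** * Automorphisms *)

(** On generators kappa is theta after T, since [kappa_rhs] is the inverse of chi_i(n) g_i(n)^-1. *)
Lemma kappa_on_flip (R : realType) (N L : nat) (q : R[i]) (C D : unitAlgType R[i])
    (chi : int -> int -> C) (x : int -> int -> D) (s : int) (f : C -> D) :
  q != 0 -> ~~ even s -> Cq_generators N L q x -> kappa_defined q x ->
  kappa_on s q chi x f <->
  forall i m, f (chi i m) = flip false s (theta q x false) i m.
Proof.
move=> hq os hx xd.
have kappaE i n : ~~ even n -> kappa_rhs q x i n = (theta q x false i n)^-1.
  move=> on; rewrite /theta (negPf on) invrM ?unitrV ?gfrac_unit ?(cg_unit hx) //.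
  by rewrite invrK /gfrac -scalerAl.
have evenB m : even (m + s) = ~~ even m by rewrite /even in os *; lia.
split=> [[fe fo] i m|fE].
  rewrite -[in LHS](addrK s m) /flip; case: (boolP (even m)) => em /=.
    by rewrite fo ?evenB ?em // kappaE // evenB em.
  by rewrite fe ?evenB // /theta evenB em.
have evenN m : even (m - s) = ~~ even m by rewrite /even in os *; lia.
split=> i n en; rewrite fE /flip evenN subrK ?en ?(negPf en) /=; last by rewrite kappaE.
by rewrite /theta en.
Qed.

Lemma flipK (R : realType) (A : unitAlgType R[i]) b s (u : int -> int -> A) i n :
  ~~ even s -> flip b s (flip (~~ b) (- s) u) i n = u i n.
Proof.
move=> os; have evenB : even (n + s) = ~~ even n by rewrite /even in os *; lia.
by rewrite /flip evenB addrK; case: (even n); case: b; rewrite /= ?invrK.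
Qed.

Lemma lrmorphism_flip (R : realType) (A B : unitAlgType R[i]) (f : {lrmorphism A -> B})
    b s (u : int -> int -> A) i n :
  (forall i n, u i n \is a GRing.unit) ->
  f (flip b s u i n) = flip b s (fun i n => f (u i n)) i n.
Proof. by move=> uu; rewrite /flip; case: ifP => _ //; rewrite rmorphV. Qed.

Lemma flip_ext (R : realType) (A : unitAlgType R[i]) b s (u v : int -> int -> A) i n :
  (forall i n, u i n = v i n) -> flip b s u i n = flip b s v i n.
Proof. by move=> uv; rewrite /flip !uv. Qed.

Lemma flip_automorphism (R : realType) (N L : nat) (q : R[i]) (C : unitAlgType R[i])
    (chi : int -> int -> C) (s : int) :
  is_Cq N L q chi -> ~~ even s ->
  exists T T' : {lrmorphism C -> C},
    [/\ forall i n, T (chi i n) = flip false s chi i n, cancel T T' & cancel T' T].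
Proof.
move=> hC os; have U := cg_unit hC.1.
have osN : ~~ even (- s) by rewrite /even rpredN.
have [T [Tx _]] := hC.2 _ _ (flip_gens false os hC.1).
have [T' [Tx' _]] := hC.2 _ _ (flip_gens true osN hC.1).
exists T, T'; split=> // a.
  apply: (lrmorphism_gens_eq hC (g := T' \o T) (h := idfun)) => i n /=.
  rewrite Tx lrmorphism_flip // (flip_ext _ _ _ _ Tx').
  exact: (flipK false).
apply: (lrmorphism_gens_eq hC (g := T \o T') (h := idfun)) => i n /=.
rewrite Tx' lrmorphism_flip // (flip_ext _ _ _ _ Tx).
by rewrite -[X in flip false X]opprK (flipK true).
Qed.

(** Injectivity makes the images of nonzero elements units, so both maps extend from [C] to [D].
    They are mutually inverse on generators because both fix the even generators, hence the
    fractions. *)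
Lemma theta_automorphism (R : realType) (N L : nat) (q : R[i])
    (C D : unitAlgType R[i]) (chi : int -> int -> C) (iota : {lrmorphism C -> D}) :
  q != 0 -> (1 < L)%N \/ (forall i n : int, q ^ Omega N L i n = 1) ->
  is_Cq N L q chi -> is_fractions iota ->
  let x := fun i n => iota (chi i n) in
  exists Th : bool -> {lrmorphism D -> D},
    (forall b i n, Th b (x i n) = theta q x b i n) /\
    forall b, cancel (Th b) (Th (~~ b)).
Proof.
move=> hq hL1 hC fr x; have xd := fractions_kappa_defined hC hq fr.
have hx : Cq_generators N L q x := image_gens iota hC.1.
have exth b : {th : {lrmorphism C -> D} |
    forall i n, th (chi i n) = theta q x b i n}.
  apply: cid; have [f [fx _]] := hC.2 _ _ (theta_gens hq hL1 hx xd b).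
  by exists f.
pose th b := sval (exth b); have thx b i n : th b (chi i n) = theta q x b i n.
  exact: (svalP (exth b)).
have exTh b : {Th : {lrmorphism D -> D} | forall a, Th (iota a) = th b a}.
  apply: cid; apply: (extend_frac fr) => a a0.
  have : th b a != 0.
    by apply: contra_neq a0; apply: (th_inj hq hL1 hC fr thx).
  have [c [d [d0 ->]]] := fr.2 (th b a) => h.
  rewrite unitrMl ?unitrV ?fr.1 //.
  by apply: contra_neq h => ->; rewrite rmorph0 mul0r.
pose Th b := sval (exTh b); have Thi b a : Th b (iota a) = th b a.
  exact: (svalP (exTh b)).
have Thx b i n : Th b (x i n) = theta q x b i n by rewrite Thi thx.
exists Th; split=> // b d.
apply: (lrmorphism_frac_eq fr (G := Th (~~ b) \o Th b) (H := idfun)) => a /=.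
apply: (lrmorphism_gens_eq hC (g := Th (~~ b) \o Th b \o iota) (h := iota)) => i n /=.
have U := cg_unit hx.
rewrite -/(x i n) Thx [in LHS]/theta; case: (boolP (even n)) => [en|on].
  by rewrite Thx /theta en.
have [e1 e2] := even_pm on.
have Thg b' : Th b' (gfrac q x i n) = gfrac q x i n.
  rewrite gfrac_morph ?U //; try by [have [] := xd i _ e1 | have [] := xd i _ e2].
  by apply: gfrac_ext => k; rewrite Thx /theta ?e1 ?e2.
have gU := gfrac_unit hq i xd on.
case: b; rewrite rmorphM /= Thx /theta (negPf on) /= ?rmorphV //= ?Thg.
  by rewrite mulrVK.
by rewrite mulrK.
Qed.

(** No completion is singled out: the first part treats every target in which the formulas make
    sense. Invertibility requires a target that kappa maps to itself, for which the second part
    takes the division algebra of fractions. *)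
Theorem proposition1 (R : realType) (N L : nat) (q : R[i])
    (hN : (0 < N)%N) (hL : (0 < L)%N) (hq : q != 0)
    (hL1 : (1 < L)%N \/ (forall i n : int, q ^ Omega N L i n = 1))
    (C : unitAlgType R[i]) (chi : int -> int -> C) (hC : is_Cq N L q chi)
    (s : int) (hs : s = 1 \/ s = -1) :
  (forall (D : unitAlgType R[i]) (iota : {lrmorphism C -> D}),
     let x := fun i n => iota (chi i n) in
     kappa_defined q x ->
     exists f : {lrmorphism C -> D},
       kappa_on s q chi x f /\
       (forall g : {lrmorphism C -> D}, kappa_on s q chi x g -> g =1 f))
  /\
  (forall (D : unitAlgType R[i]) (iota : {lrmorphism C -> D}),
     is_fractions iota ->
     let x := fun i n => iota (chi i n) in
     kappa_defined q x /\
     exists F : {lrmorphism D -> D},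
       [/\ bijective F,
           kappa_on s q chi x (fun c => F (iota c)) &
           forall G : {lrmorphism D -> D},
             kappa_on s q chi x (fun c => G (iota c)) -> G =1 F]).
Proof.
have os : ~~ even s by case: hs => ->.
split=> D iota.
  move=> x h; have hx : Cq_generators N L q x := image_gens iota hC.1.
  have [f [fx fu]] := hC.2 _ _ (flip_gens false os (theta_gens hq hL1 hx h false)).
  exists f; split; first exact/(kappa_on_flip _ _ hq os hx h).
  by move=> g /(kappa_on_flip _ _ hq os hx h)/fu.
move=> h x; have hx : Cq_generators N L q x := image_gens iota hC.1.
have xd : kappa_defined q x := fractions_kappa_defined hC hq h.
split=> //.
have [Th [Thx ThK]] := theta_automorphism hq hL1 hC h.
have [T [T' [Tx TK TK']]] := flip_automorphism hC os.
(* A left inverse makes [S] injective, so nonzero elements have invertible images in [D]. *)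
have ext (S S' : {lrmorphism C -> C}) : cancel S S' ->
    exists H : {lrmorphism D -> D}, forall a, H (iota a) = iota (S a).
  move=> SK; apply: (extend_frac h (h := iota \o S)) => a a0 /=.
  apply: h.1; apply: contra_neq a0 => Sa.
  by rewrite -(SK a) Sa rmorph0.
have [H Hi] := ext _ _ TK; have [H' Hi'] := ext _ _ TK'.
have HK : cancel H H'.
  apply: (lrmorphism_frac_eq h (G := H' \o H) (H := idfun)) => a /=.
  by rewrite Hi Hi' TK.
have HK' : cancel H' H.
  apply: (lrmorphism_frac_eq h (G := H \o H') (H := idfun)) => a /=.
  by rewrite Hi' Hi TK'.
have F_chi i n : Th false (H (iota (chi i n))) = flip false s (theta q x false) i n.
  rewrite Hi Tx !lrmorphism_flip; last by apply: (cg_unit hC.1).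
    by apply: flip_ext => j m; rewrite Thx.
  exact: (cg_unit hx).
(* Theta after the extension of T; the inverse is theta' followed by the extension of the inverse of
   T. *)
exists (Th false \o H); split.
- by exists (H' \o Th true); apply: can_comp => //; apply: (ThK true).
- exact/(kappa_on_flip _ _ hq os hx xd).
- move=> G /(kappa_on_flip _ _ hq os hx xd) Gx.
  apply: (lrmorphism_frac_eq h) => a.
  apply: (lrmorphism_gens_eq hC (g := G \o iota) (h := Th false \o H \o iota)) => i n.
  by rewrite /= Gx F_chi.
Qed.
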